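(* Let $\alpha\vDash n$. For $\mathrm{StdTab}(D)$ equal to, respectively, $\mathsf{SRCT}(\alpha)$ or $\mathsf{SYRT}(\alpha)$, the known $H_n(0)$-module on the $\mathbb{C}$-span of $\mathrm{StdTab}(D)$ for the quasisymmetric Schur functions or, respectively, the Young row-strict quasisymmetric Schur functions, is precisely the diagram module $\widehat{\mathbf{N}}_{\mathrm{StdTab}(D)}$.
   Context: Generators. $H_n(0)$ is here presented by generators $\hat\pi_1,\dots,\hat\pi_{n-1}$ with relations $\hat\pi_i^2=\hat\pi_i$, $\hat\pi_i\hat\pi_j=\hat\pi_j\hat\pi_i$ for $|i-j|\ge2$, $\hat\pi_i\hat\pi_{i+1}\hat\pi_i=\hat\pi_{i+1}\hat\pi_i\hat\pi_{i+1}$. Diagram modules. Let $D$ be a diagram of $n$ boxes with a reading order (a total order on the boxes). A standard filling is a bijective assignment of $1,\dots,n$ to the boxes; $\mathrm{rw}(T)$ is the permutation given by the entries of $T$ in reading order from left to right; $s_iT$ exchanges the entries $i,i+1$ of $T$. For a nonempty set $\mathrm{StdTab}(D)$ of standard fillings and $T\in\mathrm{StdTab}(D)$, $\mathrm{Des}(T)$ is the set of $i\in\{1,\dots,n-1\}$ with $i$ to the right of $i+1$ in $\mathrm{rw}(T)$; its elements are descents. A descent $i$ of $T$ is nonattacking if $s_iT\in\mathrm{StdTab}(D)$ and attacking otherwise. $T$ has a descent in positions $(r,s)$ if $r<s$ and $\mathrm{rw}(T)_r-\mathrm{rw}(T)_s=1$. $\mathrm{StdTab}(D)$ is descent-compatible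 if whenever $T,T'\in\mathrm{StdTab}(D)$ both have a descent in positions $(r,s)$, it is attacking in $T$ if and only if it is attacking in $T'$. In that case $\widehat{\mathbf{N}}_{\mathrm{StdTab}(D)}$ is the $H_n(0)$-module on the $\mathbb{C}$-span of $\mathrm{StdTab}(D)$ with $\hat\pi_iT=T$ if $i\notin\mathrm{Des}(T)$, $\hat\pi_iT=0$ if $i$ is an attacking descent, $\hat\pi_iT=s_iT$ if $i$ is a nonattacking descent. Tableaux. $D(\alpha)$ is the left-justified array with $\alpha_i$ boxes in row $i$, rows numbered from bottom to top; $T(c,r)$ is the entry in column $c$, row $r$. $\mathsf{SRCT}(\alpha)$: standard fillings $T$ of $D(\alpha)$ that decrease from left to right in each row, increase from bottom to top in the first column, and satisfy: if boxes $(c,r)$ and $(c+1,r')$ with $r<r'$ are in $D(\alpha)$ and $T(c,r)>T(c+1,r')$, then $(c+1,r)$ is in $D(\alpha)$ and $T(c+1,r)>T(c+1,r')$. Reading order: columns from bottom to top, starting at the rightmost column and proceeding leftwards, except that the first column (read last) is read from top to bottom. With this order $i\in\mathrm{Des}(T)$ iff $i+1$ is weakly right of $i$. $\mathsf{SYRT}(\alpha)$: standard fillings $T$ of $D(\alpha)$ that increase from left to right along rows, increase from bottom to top in the first column, and satisfy: if boxes $(c,r)$ and $(c+1,r')$ with $r'<r$ are in $D(\alpha)$ and $T(c,r)<T(c+1,r')$, then $(c+1,r)$ is in $D(\alpha)$ and $T(c+1,r)<T(c+1,r')$. Reading order: columns from top to bottom, starting at the rightmost column and proceeding leftwards, except that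 the first column (read last) is read from bottom to top. With this order $i\in\mathrm{Des}(T)$ iff $i+1$ is strictly right of $i$. Known modules (on the $\mathbb{C}$-span of the tableaux): - $\mathsf{SRCT}(\alpha)$ (Tewari and van Willigenburg): $\hat\pi_iT=T$ if $i+1$ is strictly left of $i$; $\hat\pi_iT=0$ if $i+1$ is weakly right of $i$ and either $i,i+1$ are in the same column, or $i+1$ is strictly above $i$ in the column immediately right of $i$; $\hat\pi_iT=s_iT$ otherwise. - $\mathsf{SYRT}(\alpha)$ (Bardwell and Searles): $\hat\pi_iT=T$ if $i+1$ is weakly left of $i$; $\hat\pi_iT=0$ if $i+1$ is immediately right of $i$ (same row, adjacent column); $\hat\pi_iT=s_iT$ otherwise. *)

(* Defs.v *)
From mathcomp Require Import all_boot all_order all_algebra all_fingroup finmap zify.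
From mathcomp Require Import reals complex.

Set Implicit Arguments.
Unset Strict Implicit.
Unset Printing Implicit Defensive.

Import GRing.Theory.
Local Open Scope ring_scope.

(* [H_n(0)] is given by generators and relations, so an [H_n(0)]-module is a
   vector space with operators [pi 1, ..., pi n.-1] satisfying the relations.
   Here the space is a subspace [U] of an ambient space [V]; values of [pi]
   outside [U], and at indices outside [1, n.-1], are irrelevant. *)
Record hecke0_module (K : fieldType) (V : vectType K) (n : nat)
    (U : {vspace V}) (pi : nat -> V -> V) : Prop := Hecke0Module {
  hecke0_linear : forall i, (0 < i < n)%N -> forall (a : K) (u v : V),
    u \in U -> v \in U -> pi i (a *: u + v) = a *: pi i u + pi i v;
  hecke0_stable : forall i, (0 < i < n)%N -> forall v, v \in U -> pi i v \in U;
  hecke0_idem : forall i, (0 < i < n)%N -> forall v, v \in U ->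
    pi i (pi i v) = pi i v;
  hecke0_comm : forall i j, (0 < i < n)%N -> (0 < j < n)%N ->
    (i.+2 <= j)%N || (j.+2 <= i)%N -> forall v, v \in U ->
    pi i (pi j v) = pi j (pi i v);
  hecke0_braid : forall i, (0 < i)%N -> (i.+1 < n)%N -> forall v, v \in U ->
    pi i (pi i.+1 (pi i v)) = pi i.+1 (pi i (pi i.+1 v)) }.

(* Equality of two [H_n(0)]-module structures on the same space [U]. *)
Definition same_hecke0_module (K : fieldType) (V : vectType K) (n : nat)
    (U : {vspace V}) (pi pi' : nat -> V -> V) : Prop :=
  forall i, (0 < i < n)%N -> {in U, pi i =1 pi' i}.

(* A box [(c, r)] lies in column [c] and row [r]. *)
Notation diagram := {fset nat * nat}%fset.

Definition col (D : diagram) (x : D) : nat := (val x).1.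
Definition row (D : diagram) (x : D) : nat := (val x).2.

(* [x] is read weakly before [y] when [read_le x y]. *)
Record reading_order (D : diagram) := ReadingOrder {
  read_le :> rel D;
  read_total : total read_le;
  read_anti : antisymmetric read_le;
  read_trans : transitive read_le }.

(* The label [0 : 'I_n.+1] is never used by a standard filling. *)
Definition filling (D : diagram) (n : nat) := {ffun D -> 'I_n.+1}.

Definition standard (D : diagram) (n : nat) (T : filling D n) : bool :=
  injectiveb T && [forall k : 'I_n.+1, (k \in codom T) == (0 < k)%N].

Definition swap_entries (D : diagram) (n i : nat) (T : filling D n) :
    filling D n :=
  [ffun x => tperm (inord i) (inord i.+1) (T x)].

Definition rw (D : diagram) (ro : reading_order D) (n : nat)
    (T : filling D n) : seq nat :=
  [seq (T x : nat) | x <- sort ro (enum {: D})].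

Definition descent (D : diagram) (ro : reading_order D) (n : nat)
    (T : filling D n) (i : nat) : bool :=
  (0 < i < n)%N && (index i.+1 (rw ro T) < index i (rw ro T))%N.

Definition nonattacking (D : diagram) (ro : reading_order D) (n : nat)
    (S : {set filling D n}) (T : filling D n) (i : nat) : bool :=
  descent ro T i && (swap_entries i T \in S).

Definition attacking (D : diagram) (ro : reading_order D) (n : nat)
    (S : {set filling D n}) (T : filling D n) (i : nat) : bool :=
  descent ro T i && (swap_entries i T \notin S).

(* Positions in reading words are counted from 0. *)
Definition descent_at (D : diagram) (ro : reading_order D) (n : nat)
    (T : filling D n) (r s : nat) : bool :=
  [&& (r < s)%N, (s < size (rw ro T))%N
    & nth 0%N (rw ro T) r == (nth 0%N (rw ro T) s).+1].

(* A descent in positions [(r, s)] is the descent [i = rw(T)_s]. *)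
Definition descent_compatible (D : diagram) (ro : reading_order D) (n : nat)
    (S : {set filling D n}) : Prop :=
  forall (T T' : filling D n) (r s : nat), T \in S -> T' \in S ->
    descent_at ro T r s -> descent_at ro T' r s ->
    (attacking ro S T (nth 0%N (rw ro T) s) <->
     attacking ro S T' (nth 0%N (rw ro T') s)).

(* The spans are taken inside the free vector space on all fillings, so that
   [s_i T] is a nonzero vector even when it is not a tableau of the family. *)
Definition fill_space (K : fieldType) (D : diagram) (n : nat) : vectType K :=
  {ffun filling D n -> K^o}.

Definition fill_vec (K : fieldType) (D : diagram) (n : nat)
    (T : filling D n) : fill_space K D n :=
  [ffun T' => (T' == T)%:R].

Definition tab_span (K : fieldType) (D : diagram) (n : nat)
    (S : {set filling D n}) : {vspace fill_space K D n} :=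
  <<[seq fill_vec K T | T <- enum S]>>%VS.

Definition lin_ext (K : fieldType) (D : diagram) (n : nat)
    (f : filling D n -> fill_space K D n) (v : fill_space K D n) :
    fill_space K D n :=
  \sum_(T : filling D n) (v : {ffun filling D n -> K^o}) T *: f T.

Definition diagram_op (K : fieldType) (D : diagram) (ro : reading_order D)
    (n : nat) (S : {set filling D n}) (i : nat) :
    fill_space K D n -> fill_space K D n :=
  lin_ext (fun T =>
    if ~~ descent ro T i then fill_vec K T
    else if attacking ro S T i then 0
    else fill_vec K (swap_entries i T)).

(* A module structure [pi] on the span of [S] is the diagram module of [S]:
   the diagram module is defined ([S] is a nonempty descent-compatible set of
   standard fillings), and the two structures coincide. *)
Record is_diagram_module (K : fieldType) (D : diagram) (ro : reading_order D)
    (n : nat) (S : {set filling D n})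
    (pi : nat -> fill_space K D n -> fill_space K D n) : Prop :=
  IsDiagramModule {
  dm_nonempty : S != set0;
  dm_standard : forall T, T \in S -> standard T;
  dm_compatible : descent_compatible ro S;
  dm_diagram : hecke0_module n (tab_span K S) (@diagram_op K D ro n S);
  dm_known : hecke0_module n (tab_span K S) pi;
  dm_same : same_hecke0_module n (tab_span K S) pi (@diagram_op K D ro n S) }.

Definition is_composition (n : nat) (alpha : seq nat) : bool :=
  (0%N \notin alpha) && (sumn alpha == n).

(* Rows and columns are numbered from 1, row 1 being the bottom row. *)
Definition comp_diagram (alpha : seq nat) : diagram :=
  [fset b in [seq (c, r) | r <- iota 1 (size alpha),
                           c <- iota 1 (nth 0%N alpha r.-1)]]%fset.

(* [i] and [i.+1] occupy boxes [x] and [y] of [T] such that [P x y]. *)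
Definition placed (D : diagram) (n : nat) (T : filling D n) (i : nat)
    (P : rel D) : bool :=
  [exists x : D, exists y : D,
    [&& (T x : nat) == i, (T y : nat) == i.+1 & P x y]].

Definition SRCT (alpha : seq nat) (n : nat) :
    {set filling (comp_diagram alpha) n} :=
  [set T | [&& standard T,
    [forall x, forall y,
      (row x == row y) && (col x < col y)%N ==> (T y < T x)%N],
    [forall x, forall y,
      [&& col x == 1%N, col y == 1%N & (row x < row y)%N] ==> (T x < T y)%N]
  & [forall x, forall y,
      [&& col y == (col x).+1, (row x < row y)%N & (T y < T x)%N] ==>
      [exists z,
        [&& col z == (col x).+1, row z == row x & (T y < T z)%N]]]]].

Definition srct_le (D : diagram) : rel D := fun x y =>
  (col y < col x)%N || (col x == col y) &&
  (if col x == 1%N then (row y <= row x)%N else (row x <= row y)%N).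

Lemma srct_le_total (D : diagram) : total (@srct_le D).
Proof. by move=> x y; rewrite /srct_le; do !case: ifP; lia. Qed.

Lemma srct_le_anti (D : diagram) : antisymmetric (@srct_le D).
Proof.
move=> x y; rewrite /srct_le /col /row => h; apply/val_inj.
move: h; case: (val x) (val y) => [a b] [c d] /= h.
suff [-> ->] : a = c /\ b = d by [].
by move: h; do !case: ifP; lia.
Qed.

Lemma srct_le_trans (D : diagram) : transitive (@srct_le D).
Proof. by move=> y x z; rewrite /srct_le; do !case: ifP; lia. Qed.

Definition srct_order (D : diagram) : reading_order D :=
  ReadingOrder (@srct_le_total D) (@srct_le_anti D) (@srct_le_trans D).

(* The action of Tewari and van Willigenburg. *)
Definition srct_op (K : fieldType) (alpha : seq nat) (n i : nat) :
    fill_space K (comp_diagram alpha) n -> fill_space K (comp_diagram alpha) n :=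
  lin_ext (fun T =>
    if placed T i (fun x y => col y < col x)%N then fill_vec K T
    else if placed T i (fun x y => (col x <= col y)%N &&
              ((col x == col y) ||
               (row x < row y)%N && (col y == (col x).+1))) then 0
    else fill_vec K (swap_entries i T)).

Definition SYRT (alpha : seq nat) (n : nat) :
    {set filling (comp_diagram alpha) n} :=
  [set T | [&& standard T,
    [forall x, forall y,
      (row x == row y) && (col x < col y)%N ==> (T x < T y)%N],
    [forall x, forall y,
      [&& col x == 1%N, col y == 1%N & (row x < row y)%N] ==> (T x < T y)%N]
  & [forall x, forall y,
      [&& col y == (col x).+1, (row y < row x)%N & (T x < T y)%N] ==>
      [exists z,
        [&& col z == (col x).+1, row z == row x & (T z < T y)%N]]]]].

Definition syrt_le (D : diagram) : rel D := fun x y =>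
  (col y < col x)%N || (col x == col y) &&
  (if col x == 1%N then (row x <= row y)%N else (row y <= row x)%N).

Lemma syrt_le_total (D : diagram) : total (@syrt_le D).
Proof. by move=> x y; rewrite /syrt_le; do !case: ifP; lia. Qed.

Lemma syrt_le_anti (D : diagram) : antisymmetric (@syrt_le D).
Proof.
move=> x y; rewrite /syrt_le /col /row => h; apply/val_inj.
move: h; case: (val x) (val y) => [a b] [c d] /= h.
suff [-> ->] : a = c /\ b = d by [].
by move: h; do !case: ifP; lia.
Qed.

Lemma syrt_le_trans (D : diagram) : transitive (@syrt_le D).
Proof. by move=> y x z; rewrite /syrt_le; do !case: ifP; lia. Qed.

Definition syrt_order (D : diagram) : reading_order D :=
  ReadingOrder (@syrt_le_total D) (@syrt_le_anti D) (@syrt_le_trans D).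

(* The action of Bardwell and Searles. *)
Definition syrt_op (K : fieldType) (alpha : seq nat) (n i : nat) :
    fill_space K (comp_diagram alpha) n -> fill_space K (comp_diagram alpha) n :=
  lin_ext (fun T =>
    if placed T i (fun x y => col y <= col x)%N then fill_vec K T
    else if placed T i (fun x y => (row x == row y) && (col y == (col x).+1))
      then 0
    else fill_vec K (swap_entries i T)).

(* Main.v *)
(** Descent compatibility says that, for a descent, whether exchanging [i] and
    [i.+1] stays in the family depends only on the two boxes involved. Applying
    an operator either fixes a tableau, kills it, or exchanges two labels, so
    the commutation relations are immediate, and in the braid relation the
    only serious case is that of boxes [x], [y], [z] labelled [i], [i.+1],
    [i.+2] and read in the order [z], [y], [x]: both sides then test the pairs
    [(x, y)], [(x, z)], [(y, z)], in opposite orders, and exchange the labels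
    of [x] and [z] if no test fails.

    For the two families of tableaux, comparing the triple rule at the box
    left of [i] or [i.+1] decides the relative position of [i] and [i.+1] when
    they share a column, so descents are read off the columns of these labels.
    Exchanging them can only break a condition comparing the two labels
    directly, which singles out the attacking pairs of boxes. Filling the rows
    one after the other shows that the families are nonempty. *)

From mathcomp Require Import all_boot all_order all_algebra all_fingroup finmap zify.
From mathcomp Require Import reals complex.
(* After MathComp, whose matrix [row] and [col] would shadow those of boxes. *)
Require Import Defs.

Set Implicit Arguments.
Unset Strict Implicit.
Unset Printing Implicit Defensive.

Import GRing.Theory.

(** * Standard fillings and exchanges of consecutive labels *)

Section Fillings.

Context (D : diagram) (n : nat).
Implicit Types (T : filling D n) (x y z : D).

Lemma standard_inj T x y : standard T -> T x = T y :> nat -> x = y.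
Proof. by case/andP=> /injectiveP Tinj _ /val_inj/Tinj. Qed.

Lemma standard_gt0 T x : standard T -> 0 < T x.
Proof. by case/andP=> _ /forallP/(_ (T x))/eqP <-; apply: codom_f. Qed.

Lemma standard_box T k : standard T -> 0 < k <= n ->
  exists x, T x = k :> nat.
Proof.
case/andP=> _ /forallP/(_ (inord k)) + /andP[k0 kn].
rewrite inordK ?ltnS // k0 => /eqP/codomP[x Tx].
by exists x; rewrite -Tx inordK.
Qed.

Lemma val_swap_entries T i x : i < n ->
  swap_entries i T x =
    (if T x == i :> nat then i.+1 else if T x == i.+1 :> nat then i else T x)
    :> nat.
Proof.
move=> lt_in; rewrite ffunE permE /=.
have Ei : (inord i : 'I_n.+1) = i :> nat by rewrite inordK // ltnW.
have Ei1 : (inord i.+1 : 'I_n.+1) = i.+1 :> nat by rewrite inordK.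
rewrite -!val_eqE /= Ei Ei1.
by case: ifP => _; [|case: ifP => _].
Qed.

Lemma swap_entries_lo T i x : i < n ->
  T x = i :> nat -> swap_entries i T x = i.+1 :> nat.
Proof. by move=> lt_in Tx; rewrite val_swap_entries // Tx eqxx. Qed.

Lemma swap_entries_hi T i x : i < n ->
  T x = i.+1 :> nat -> swap_entries i T x = i :> nat.
Proof. by move=> lt_in Tx; rewrite val_swap_entries // Tx eqxx; case: ifP; lia. Qed.

Lemma swap_entries_id T i k x : i < n -> k != i -> k != i.+1 ->
  T x = k :> nat -> swap_entries i T x = k :> nat.
Proof.
by move=> lt_in /negPf ki /negPf ki1 Tx; rewrite val_swap_entries // Tx ki ki1.
Qed.

Lemma swap_entries_comm T i j : i < n -> j < n -> i.+2 <= j \/ j.+2 <= i ->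
  swap_entries i (swap_entries j T) = swap_entries j (swap_entries i T).
Proof.
move=> i_n j_n ij; apply/ffunP => x; apply: val_inj.
rewrite /= !val_swap_entries //; move: (T x : nat) => t.
by case: (t =P i); case: (t =P i.+1); case: (t =P j); case: (t =P j.+1) => /=;
  do ?[case: eqP => //= ?]; lia.
Qed.

Lemma swap_entries_braid T i : i.+1 < n ->
  swap_entries i (swap_entries i.+1 (swap_entries i T)) =
  swap_entries i.+1 (swap_entries i (swap_entries i.+1 T)).
Proof.
move=> i_n; have i_n' := ltnW i_n; apply/ffunP => x; apply: val_inj.
rewrite /= !val_swap_entries //; move: (T x : nat) => t.
have neqS k : (k == k.+1) = false by lia.
have neqSr k : (k.+1 == k) = false by lia.
have neqSS k : (k == k.+2) = false by lia.
have neqSSr k : (k.+2 == k) = false by lia.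
have [/eqP e|/negPf ni] := boolP (t == i).
  by do ?rewrite ?e ?eqxx ?neqS ?neqSr ?neqSS ?neqSSr.
have [/eqP e|/negPf ni1] := boolP (t == i.+1).
  by do ?rewrite ?e ?eqxx ?neqS ?neqSr ?neqSS ?neqSSr.
have [/eqP e|/negPf ni2] := boolP (t == i.+2).
  by do ?rewrite ?e ?eqxx ?neqS ?neqSr ?neqSS ?neqSSr.
by do ?rewrite ?ni ?ni1 ?ni2.
Qed.

Lemma placedE T i (P : rel D) x y : standard T ->
  T x = i :> nat -> T y = i.+1 :> nat -> placed T i P = P x y.
Proof.
move=> Tst Tx Ty; apply/existsP/idP => [[x' /existsP[y']]|Pxy].
  case/and3P=> /eqP Tx' /eqP Ty'.
  by rewrite (standard_inj Tst (etrans Tx' (esym Tx)))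
    (standard_inj Tst (etrans Ty' (esym Ty))).
by exists x; apply/existsP; exists y; rewrite Tx Ty !eqxx.
Qed.

Lemma standard_swap_entries T i : 0 < i < n -> standard T ->
  standard (swap_entries i T).
Proof.
move=> /andP[i0 lt_in] Tst; have /andP[/injectiveP Tinj /forallP Tsur] := Tst.
apply/andP; split.
  by apply/injectiveP => x y; rewrite !ffunE => /perm_inj/Tinj.
apply/forallP => k; set t := tperm (inord i : 'I_n.+1) (inord i.+1).
have -> : (k \in codom (swap_entries i T)) = (t k \in codom T).
  apply/codomP/codomP => [[x ->]|[x Tx]]; exists x; rewrite ffunE -/t.
    by rewrite tpermK.
  by rewrite -Tx tpermK.
rewrite (eqP (Tsur (t k))); apply/eqP; rewrite /t permE /=.
have Ei : (inord i : 'I_n.+1) = i :> nat by rewrite inordK // ltnW.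
have Ei1 : (inord i.+1 : 'I_n.+1) = i.+1 :> nat by rewrite inordK.
by rewrite -!val_eqE /= Ei Ei1; case: ifP; [|case: ifP]; rewrite ?Ei ?Ei1; lia.
Qed.

(** * Reading words and descents in terms of boxes *)

Section ReadingOrder.

Context (ro : reading_order D).

Definition read_lt x y : bool := ro x y && (x != y).

Let boxes := sort ro (enum {: D}).

Let mem_boxes x : x \in boxes.
Proof. by rewrite mem_sort mem_enum. Qed.

Let index_boxes_inj x y : index x boxes = index y boxes -> x = y.
Proof. by move/(index_inj x (mem_boxes x) (mem_boxes y)). Qed.

Lemma index_boxes_lt x y : (index x boxes < index y boxes) = read_lt x y.
Proof.
have srt : sorted ro boxes := sort_sorted (@read_total _ ro) _.
have ltw := sorted_ltn_index (@read_trans _ ro) srt.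
rewrite /read_lt; have [-> | nxy] := eqVneq; first by rewrite ltnn andbF.
rewrite andbT; apply/idP/idP => [|rxy]; first exact: ltw.
rewrite ltnNge; apply/negP; rewrite leq_eqVlt => /orP[/eqP e|].
  by rewrite (index_boxes_inj e) eqxx in nxy.
by move/(ltw _ _ (mem_boxes y) (mem_boxes x)) => ryx;
  rewrite (@read_anti _ ro x y) ?rxy ?eqxx in nxy.
Qed.

Lemma read_lt_trans y x z : read_lt x y -> read_lt y z -> read_lt x z.
Proof. by rewrite -!index_boxes_lt; apply: ltn_trans. Qed.

Lemma read_lt_asym x y : read_lt x y -> read_lt y x = false.
Proof. by rewrite -!index_boxes_lt; lia. Qed.

Lemma index_rw T x : standard T -> index (T x : nat) (rw ro T) = index x boxes.
Proof.
move=> Tst; rewrite /rw (index_map (f := fun x => T x : nat)) //.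
by move=> u v; apply: standard_inj.
Qed.

Lemma nth_rw T x : nth 0 (rw ro T) (index x boxes) = T x.
Proof. by rewrite (nth_map x) ?nth_index ?index_mem. Qed.

Lemma descentE T i x y : 0 < i < n -> standard T ->
  T x = i :> nat -> T y = i.+1 :> nat -> descent ro T i = read_lt y x.
Proof.
move=> i_n Tst Tx Ty.
by rewrite /descent i_n -Ty -Tx !index_rw // index_boxes_lt.
Qed.

Lemma descent_atP T r s : descent_at ro T r s ->
  exists x y, [/\ index y boxes = r, index x boxes = s, read_lt y x,
    T y = (T x).+1 :> nat & nth 0 (rw ro T) s = T x :> nat].
Proof.
case/and3P => lt_rs; rewrite /rw size_map -/boxes => lt_s.
have [x0 _ _] : exists2 x0 : D, x0 \in boxes & true.
  by case: boxes lt_s => // x0 b _; exists x0; rewrite ?mem_head.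
have lt_r := ltn_trans lt_rs lt_s.
have uniq_boxes : uniq boxes by rewrite sort_uniq enum_uniq.
rewrite !(nth_map x0) // => /eqP Txy.
exists (nth x0 boxes s), (nth x0 boxes r).
by rewrite -index_boxes_lt !index_uniq.
Qed.

(** * The operators on tableaux and their relations *)

Section Module.

Context (K : fieldType) (S : {set filling D n}).
Hypothesis S_std : forall T, T \in S -> standard T.

(** Every reading word lists the boxes in the same sorted order, so a common pair of positions is a
    common pair of boxes. The labels there may be different pairs, [i, i.+1] in [T] and [j, j.+1] in
    [T']; the braid relation needs this freedom. *)
Lemma descent_compatibleP :
  descent_compatible ro S <->
  (forall T T' i j x y, T \in S -> T' \in S -> 0 < i < n -> 0 < j < n ->
    T x = i :> nat -> T y = i.+1 :> nat ->
    T' x = j :> nat -> T' y = j.+1 :> nat -> read_lt y x ->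
    (swap_entries i T \in S) = (swap_entries j T' \in S)).
Proof.
split=> [compS T T' i j x y TS TS' i_n j_n Tx Ty Tx' Ty' yx | compS].
  have desc_at T1 k : T1 \in S -> T1 x = k :> nat -> T1 y = k.+1 :> nat ->
      nth 0 (rw ro T1) (index x boxes) = k /\
      descent_at ro T1 (index y boxes) (index x boxes).
    move=> T1S T1x T1y; have T1st := S_std T1S.
    rewrite /descent_at !nth_rw T1x T1y eqxx index_boxes_lt yx.
    by rewrite size_map index_mem mem_boxes.
  have [Ei di] := desc_at _ _ TS Tx Ty; have [Ej dj] := desc_at _ _ TS' Tx' Ty'.
  have := compS _ _ _ _ TS TS' di dj; rewrite Ei Ej /attacking.
  rewrite (descentE i_n (S_std TS) Tx Ty) (descentE j_n (S_std TS') Tx' Ty').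
  by rewrite yx /= => -[le ge]; apply: negb_inj; apply/idP/idP.
move=> T T' r s TS TS' /descent_atP[x [y [yr xs yx Txy ->]]].
move=> /descent_atP[x' [y' [yr' xs' _ Txy' ->]]].
have Ex : x = x' by apply: index_boxes_inj; rewrite xs xs'.
have Ey : y = y' by apply: index_boxes_inj; rewrite yr yr'.
rewrite -Ex; rewrite -Ex -Ey in Txy' => {x' xs' y' yr' Ex Ey}.
have rng T1 : T1 \in S -> T1 y = (T1 x).+1 :> nat -> 0 < T1 x < n.
  by move=> T1S E; rewrite standard_gt0 ?S_std // -ltnS -E ltn_ord.
have i_n := rng T TS Txy; have j_n := rng T' TS' Txy'.
rewrite /attacking (descentE i_n (S_std TS) erefl Txy) yx.
rewrite (descentE j_n (S_std TS') erefl Txy') yx /=.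
by rewrite (compS T T' _ _ x y TS TS' i_n j_n).
Qed.

(** An operator sends a tableau to a tableau or to zero; [None] stands for zero. *)
Definition step i T : option (filling D n) :=
  if ~~ descent ro T i then Some T
  else if swap_entries i T \in S then Some (swap_entries i T) else None.

Lemma step_stable i T T' : T \in S -> step i T = Some T' -> T' \in S.
Proof.
by rewrite /step => TS; case: ifP => _; [|case: ifP => // ?] => -[<-].
Qed.

Hypothesis compS : descent_compatible ro S.

Let compS' := (descent_compatibleP.1 compS).

Lemma stepE i T x y : 0 < i < n -> T \in S ->
  T x = i :> nat -> T y = i.+1 :> nat ->
  step i T = if ~~ read_lt y x then Some T
  else if swap_entries i T \in S then Some (swap_entries i T) else None.
Proof. by move=> i_n TS Tx Ty; rewrite /step (descentE i_n (S_std TS) Tx Ty). Qed.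

Lemma step_idem i T : 0 < i < n -> T \in S ->
  obind (step i) (step i T) = step i T.
Proof.
move=> i_n TS; have [_ lt_in] := andP i_n.
have [|x Tx] := standard_box (k := i) (S_std TS); first by lia.
have [|y Ty] := standard_box (k := i.+1) (S_std TS); first by lia.
rewrite (stepE i_n TS Tx Ty); case: ifPn => [yx | /negPn yx] /=.
  by rewrite (stepE i_n TS Tx Ty) yx.
(* After the exchange [i] sits in [y] and [i.+1] in [x], so [i] has ceased to be a descent and the
   second application fixes the tableau. *)
case: ifP => // sTS /=; rewrite (stepE (x := y) (y := x) i_n sTS).
- by rewrite read_lt_asym.
- exact: swap_entries_hi.
- exact: swap_entries_lo.
Qed.

(** The two label pairs are disjoint, so one exchange leaves the boxes of the other pair in place;
    by compatibility it also leaves the outcome of the other test unchanged. *)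
Lemma step_comm i j T : 0 < i < n -> 0 < j < n -> i.+2 <= j \/ j.+2 <= i ->
  T \in S -> obind (step i) (step j T) = obind (step j) (step i T).
Proof.
move=> i_n j_n ij TS; have [_ lt_in] := andP i_n; have [_ lt_jn] := andP j_n.
have [|x Tx] := standard_box (k := i) (S_std TS); first by lia.
have [|y Ty] := standard_box (k := i.+1) (S_std TS); first by lia.
have [|u Tu] := standard_box (k := j) (S_std TS); first by lia.
have [|v Tv] := standard_box (k := j.+1) (S_std TS); first by lia.
have sx : swap_entries j T x = i :> nat by apply: swap_entries_id => //; lia.
have sy : swap_entries j T y = i.+1 :> nat by apply: swap_entries_id => //; lia.
have su : swap_entries i T u = j :> nat by apply: swap_entries_id => //; lia.
have sv : swap_entries i T v = j.+1 :> nat by apply: swap_entries_id => //; lia.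
have Ei := stepE i_n TS Tx Ty; have Ej := stepE j_n TS Tu Tv.
have Eij sTS := stepE i_n (T := swap_entries j T) sTS sx sy.
have Eji sTS := stepE j_n (T := swap_entries i T) sTS su sv.
have Cij sTS := compS' sTS TS i_n i_n sx sy Tx Ty.
have Cji sTS := compS' sTS TS j_n j_n su sv Tu Tv.
rewrite Ei Ej; case: ifPn => [nvu | /negPn vu] /=.
  rewrite Ei; case: ifPn => [nyx | /negPn yx] /=; first by rewrite Ej nvu.
  by case: ifP => //= sTS; rewrite Eji // nvu.
case: ifP => //= [jTS | njTS].
  rewrite Eij //; case: ifPn => [nyx | /negPn yx] /=; first by rewrite Ej vu jTS.
  rewrite Cij //; case: ifP => //= iTS.
  by rewrite Eji // vu Cji // jTS swap_entries_comm.
case: ifPn => [nyx | /negPn yx] /=; first by rewrite Ej vu njTS.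
by case: ifP => //= iTS; rewrite Eji // vu Cji // njTS.
Qed.

Lemma step_braid i T : 0 < i -> i.+1 < n -> T \in S ->
  obind (step i) (obind (step i.+1) (step i T)) =
  obind (step i.+1) (obind (step i) (step i.+1 T)).
Proof.
move=> i0 lt_i1n TS; have lt_in := ltnW lt_i1n.
have i_n : 0 < i < n by rewrite i0.
have [|x Tx] := standard_box (k := i) (S_std TS); first by lia.
have [|y Ty] := standard_box (k := i.+1) (S_std TS); first by lia.
have [|z Tz] := standard_box (k := i.+2) (S_std TS); first by lia.
have nxy : x != y by apply: contra_eq_neq Tx => ->; rewrite Ty; lia.
have nxz : x != z by apply: contra_eq_neq Tx => ->; rewrite Tz; lia.
have nyz : y != z by apply: contra_eq_neq Ty => ->; rewrite Tz; lia.
(* [F] tracks which boxes carry the three labels, so that every application becomes a test on a pair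
   of boxes. *)
pose F T a b c := [/\ T \in S, T a = i :> nat, T b = i.+1 :> nat
                     & T c = i.+2 :> nat].
have F0 : F T x y z by [].
have E0 T1 a b c : F T1 a b c -> step i T1 = if ~~ read_lt b a then Some T1
    else if swap_entries i T1 \in S then Some (swap_entries i T1) else None.
  by case=> T1S Ta Tb _; apply: stepE.
have E1 T1 a b c : F T1 a b c -> step i.+1 T1 = if ~~ read_lt c b then Some T1
    else if swap_entries i.+1 T1 \in S then Some (swap_entries i.+1 T1)
    else None.
  by case=> T1S _ Tb Tc; apply: stepE.
have F_lo T1 a b c : F T1 a b c -> swap_entries i T1 \in S ->
    F (swap_entries i T1) b a c.
  case=> T1S Ta Tb Tc sS; split=> //; first exact: swap_entries_hi.
    exact: swap_entries_lo.
  by apply: swap_entries_id => //; lia.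
have F_hi T1 a b c : F T1 a b c -> swap_entries i.+1 T1 \in S ->
    F (swap_entries i.+1 T1) a c b.
  case=> T1S Ta Tb Tc sS; split=> //; first by apply: swap_entries_id => //; lia.
    exact: swap_entries_hi.
  exact: swap_entries_lo.
(* Compatibility carries the test of [(a, b)] from labels [i, i.+1] to labels [i.+1, i.+2]; this
   matches the tests on the two sides of the relation. *)
have C T1 T2 a b c c' : F T1 a b c -> F T2 c' a b -> read_lt b a ->
    (swap_entries i T1 \in S) = (swap_entries i.+1 T2 \in S).
  by case=> T1S Ta Tb _ [T2S _ Ta' Tb']; apply: compS'.
rewrite (E0 _ _ _ _ F0) (E1 _ _ _ _ F0).
case: (boolP (read_lt y x)) => yx; case: (boolP (read_lt z y)) => zy /=.
- have zx := read_lt_trans zy yx.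
  case: (boolP (swap_entries i T \in S)) => iTS /=.
    have F1 := F_lo _ _ _ _ F0 iTS.
    rewrite (E1 _ _ _ _ F1) zx /=.
    case: (boolP (swap_entries _ (swap_entries i T) \in S)) => jiTS /=.
      have F2 := F_hi _ _ _ _ F1 jiTS.
      rewrite (E0 _ _ _ _ F2) zy /=.
      rewrite (C _ _ _ _ _ _ F2 F0) //; case: ifP => //= jTS.
      have F1' := F_hi _ _ _ _ F0 jTS.
      rewrite (E0 _ _ _ _ F1') zx /= (C _ _ _ _ _ _ F1' F1) // jiTS /=.
      have F2' := F_lo _ _ _ _ F1' (etrans (C _ _ _ _ _ _ F1' F1 zx) jiTS).
      rewrite (E1 _ _ _ _ F2') yx /= -(C _ _ _ _ _ _ F0 F2') // iTS.
      by rewrite swap_entries_braid.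
    case: ifP => //= jTS; have F1' := F_hi _ _ _ _ F0 jTS.
    by rewrite (E0 _ _ _ _ F1') zx /= (C _ _ _ _ _ _ F1' F1) // (negPf jiTS).
  case: ifP => //= jTS; have F1' := F_hi _ _ _ _ F0 jTS.
  rewrite (E0 _ _ _ _ F1') zx /=; case: ifP => //= ijTS.
  have F2' := F_lo _ _ _ _ F1' ijTS.
  by rewrite (E1 _ _ _ _ F2') yx /= -(C _ _ _ _ _ _ F0 F2') // (negPf iTS).
(* Now [i.+1] is not a descent of [T], so the first application on the right is trivial. The last
   one on the left is trivial too: whether or not [x] and [z] were exchanged, [i] is not a descent
   at that stage. *)
- rewrite (E0 _ _ _ _ F0) yx /=; case: ifP => //= iTS.
  have F1 := F_lo _ _ _ _ F0 iTS.
  rewrite (E1 _ _ _ _ F1); case: (boolP (read_lt z x)) => zx /=.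
    case: ifP => //= jiTS; rewrite (E0 _ _ _ _ (F_hi _ _ _ _ F1 jiTS)).
    by rewrite zy.
  by rewrite (E0 _ _ _ _ F1) read_lt_asym.
(* The mirror case: the first application on the left and the last one on the right are trivial. *)
- rewrite (E1 _ _ _ _ F0) zy /=; case: ifP => //= jTS.
  have F1 := F_hi _ _ _ _ F0 jTS.
  rewrite (E0 _ _ _ _ F1); case: (boolP (read_lt z x)) => zx /=.
    case: ifP => //= ijTS; rewrite (E1 _ _ _ _ (F_lo _ _ _ _ F1 ijTS)).
    by rewrite yx.
  by rewrite (E1 _ _ _ _ F1) read_lt_asym.
by rewrite (E1 _ _ _ _ F0) zy /= (E0 _ _ _ _ F0) yx /= (E1 _ _ _ _ F0) zy.
Qed.

End Module.
End ReadingOrder.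
End Fillings.

(** * From tableaux to their linear span *)

Section Span.

Local Open Scope ring_scope.

Context (K : fieldType) (D : diagram) (n : nat) (S : {set filling D n}).
Implicit Types (T : filling D n) (f : filling D n -> fill_space K D n).

Lemma lin_extP f a u v :
  lin_ext f (a *: u + v) = a *: lin_ext f u + lin_ext f v.
Proof.
rewrite /lin_ext scaler_sumr -big_split; apply: eq_bigr => T _ /=.
by rewrite !ffunE scalerDl scalerA.
Qed.

Lemma lin_ext0 f : lin_ext f 0 = 0.
Proof. by rewrite /lin_ext big1 // => T _; rewrite ffunE scale0r. Qed.

Lemma lin_ext_fill_vec f T : lin_ext f (fill_vec K T) = f T.
Proof.
rewrite /lin_ext (bigD1 T) //= big1 ?addr0 => [|T' /negPf nTT'].
  by rewrite ffunE eqxx scale1r.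
by rewrite ffunE nTT' scale0r.
Qed.

Lemma fill_vec_span T : T \in S -> fill_vec K T \in tab_span K S.
Proof. by move=> TS; apply/memv_span/map_f; rewrite mem_enum. Qed.

Lemma tab_span_ind (P : fill_space K D n -> Prop) :
  (forall a u v, P u -> P v -> P (a *: u + v)) -> P 0 ->
  (forall T, T \in S -> P (fill_vec K T)) ->
  forall v, v \in tab_span K S -> P v.
Proof.
move=> Plin P0 Pvec v; rewrite /tab_span -[X in <<X>>%VS]in_tupleE.
move/coord_span ->; apply: (big_ind P) => // [u w Pu Pw | k _].
  by rewrite -[u]scale1r; apply: Plin.
rewrite -[_ *: _]addr0; apply: Plin => //; rewrite in_tupleE.
have /mapP[T] : [seq fill_vec K T | T <- enum S]`_k \in
    [seq fill_vec K T | T <- enum S] by apply: mem_nth.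
by rewrite mem_enum => TS ->; apply: Pvec.
Qed.

(** The operators agree on the span only, so stability under [pi'] is what allows rewriting nested
    applications. *)
Lemma hecke0_module_eq (pi pi' : nat -> fill_space K D n -> fill_space K D n) :
  same_hecke0_module n (tab_span K S) pi pi' ->
  hecke0_module n (tab_span K S) pi' -> hecke0_module n (tab_span K S) pi.
Proof.
move=> E [lin stable idem comm braid].
have stab i v : (0 < i < n)%N -> v \in tab_span K S -> pi' i v \in tab_span K S.
  by move=> i_n; apply: stable.
split=> [i i_n a u v uU vU|i i_n v vU|i i_n v vU|i j i_n j_n ij v vU|i i0 i1n v vU].
- by rewrite !E ?lin // rpredD ?rpredZ.
- by rewrite E // stab.
- by rewrite !E ?idem // stab.
- by rewrite !E ?stab //; apply: comm.
have i_n : (0 < i < n)%N by rewrite i0 ltnW.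
by rewrite !E ?stab //; apply: braid.
Qed.

Context (ro : reading_order D).
Hypothesis S_std : forall T, T \in S -> standard T.
Hypothesis compS : descent_compatible ro S.

Let vec (o : option (filling D n)) : fill_space K D n := oapp (@fill_vec K D n) 0 o.

(** Compositions of operators become iterated [obind], which reduces the module relations to those
    of [step]. *)
Lemma diagram_op_step i o :
  diagram_op ro S i (vec o) = vec (obind (step ro S i) o).
Proof.
case: o => [T|]; last exact: lin_ext0.
rewrite /vec /= /diagram_op lin_ext_fill_vec /step /attacking.
by case: ifP => //= /negbFE ->; case: (_ \in S).
Qed.

Lemma diagram_module : hecke0_module n (tab_span K S) (@diagram_op K D ro n S).
Proof.
have basis (L M : fill_space K D n -> fill_space K D n) :
    (forall a u v, L (a *: u + v) = a *: L u + L v) ->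
    (forall a u v, M (a *: u + v) = a *: M u + M v) -> L 0 = M 0 ->
    (forall T, T \in S -> L (vec (Some T)) = M (vec (Some T))) ->
    forall v, v \in tab_span K S -> L v = M v.
  by move=> Ll Ml L0 LM; apply: tab_span_ind => // a u v; rewrite Ll Ml => -> ->.
split=> [i i_n a u v _ _|i i_n|i i_n|i j i_n j_n ij|i i0 i1n].
- exact: lin_extP.
- apply: tab_span_ind => [a u v uS vS||T TS].
  + by rewrite /diagram_op lin_extP rpredD ?rpredZ.
  + by rewrite /diagram_op lin_ext0 rpred0.
  rewrite (diagram_op_step i (Some T)) /=.
  case E: (step ro S i T) => [T'|] /=; last exact: rpred0.
  exact/fill_vec_span/(step_stable TS E).
- apply: basis => [a u v|a u v||T TS]; rewrite ?diagram_op_step.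
  + by rewrite /diagram_op !lin_extP.
  + by rewrite /diagram_op !lin_extP.
  + by rewrite /diagram_op !lin_ext0.
  by rewrite /= step_idem.
- apply: basis => [a u v|a u v||T TS]; rewrite ?diagram_op_step.
  + by rewrite /diagram_op !lin_extP.
  + by rewrite /diagram_op !lin_extP.
  + by rewrite /diagram_op !lin_ext0.
  by rewrite /= step_comm //; apply/orP.
apply: basis => [a u v|a u v||T TS]; rewrite ?diagram_op_step.
- by rewrite /diagram_op !lin_extP.
- by rewrite /diagram_op !lin_extP.
- by rewrite /diagram_op !lin_ext0.
by rewrite /= step_braid.
Qed.

End Span.

(** * A criterion for families whose attacking pairs depend on boxes alone *)

(** Here [asc] detects the absence of a descent and [att] an attacking one. Neither looks at labels,
    which gives compatibility; the two actions then agree on each tableau, and the known one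
    inherits the relations from the diagram module. *)
Lemma local_diagram_module (K : fieldType) (D : diagram) (n : nat)
    (S : {set filling D n}) (ro : reading_order D) (asc att : rel D) :
  S != set0 -> (forall T, T \in S -> standard T) ->
  (forall T i x y, T \in S -> T x = i :> nat -> T y = i.+1 :> nat ->
    read_lt ro y x = ~~ asc x y) ->
  (forall T i x y, T \in S -> 0 < i < n ->
    T x = i :> nat -> T y = i.+1 :> nat -> ~~ asc x y ->
    (swap_entries i T \in S) = ~~ att x y) ->
  is_diagram_module ro S (fun i => lin_ext (fun T =>
    if placed T i asc then fill_vec K T
    else if placed T i att then 0%R else fill_vec K (swap_entries i T))).
Proof.
move=> S0 S_std ascE attE.
have compS : descent_compatible ro S.
  apply/(descent_compatibleP ro S_std).
  move=> T T' i j x y TS TS' i_n j_n Tx Ty Tx' Ty' yx.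
  have nasc : ~~ asc x y by rewrite -(ascE T i).
  by rewrite (attE T i x y) // (attE T' j x y).
have dm := diagram_module K S_std compS.
have same : same_hecke0_module n (tab_span K S) (fun i => lin_ext (fun T =>
    if placed T i asc then fill_vec K T
    else if placed T i att then 0%R else fill_vec K (swap_entries i T)))
    (@diagram_op K D ro n S).
  move=> i i_n; apply: tab_span_ind => [a u v||T TS].
  - by rewrite /diagram_op !lin_extP => -> ->.
  - by rewrite /diagram_op !lin_ext0.
  have Tst := S_std T TS.
  have [|x Tx] := standard_box (k := i) Tst; first by lia.
  have [|y Ty] := standard_box (k := i.+1) Tst; first by lia.
  rewrite /diagram_op !lin_ext_fill_vec !(placedE _ Tst Tx Ty) /attacking.
  rewrite (descentE ro i_n Tst Tx Ty) (ascE T i) // negbK.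
  by case: ifPn => //= nasc; rewrite (attE T i x y) // negbK.
by split=> //; apply: hecke0_module_eq same dm.
Qed.

(** No label lies strictly between [i] and [i.+1], so exchanging them reverses no other
    comparison. *)
Lemma swap_entries_lt (D : diagram) n (T : filling D n) i (u v : D) : i < n ->
  T u < T v ->
  (T u = i :> nat /\ T v = i.+1 :> nat) \/ swap_entries i T u < swap_entries i T v.
Proof.
move=> lt_in; rewrite !val_swap_entries //.
by case: eqP => ?; do ?case: eqP => ?; lia.
Qed.

Lemma swap_entries_gt (D : diagram) n (T : filling D n) i (u v : D) : i < n ->
  swap_entries i T u < swap_entries i T v ->
  (T u = i.+1 :> nat /\ T v = i :> nat) \/ T u < T v.
Proof.
move=> lt_in; rewrite !val_swap_entries //.
by case: eqP => ?; do ?case: eqP => ?; lia.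
Qed.

Lemma box_eq (D : diagram) (x y : D) : col x = col y -> row x = row y -> x = y.
Proof.
rewrite /col /row => ec er; apply: val_inj.
by case: (val x) (val y) ec er => [? ?] [? ?] /= -> ->.
Qed.

(** * Boxes of a composition diagram *)

Section CompositionDiagram.

Context (alpha : seq nat).
Implicit Types (x y z w : comp_diagram alpha).

Lemma in_comp_diagram (b : nat * nat) : (b \in comp_diagram alpha) =
  (0 < b.2 <= size alpha) && (0 < b.1 <= nth 0 alpha b.2.-1).
Proof.
case: b => c r; rewrite !inE /=; apply/allpairsPdep/idP => [[r' [c' []]]|].
  by rewrite !mem_iota => ? ? [-> ->]; lia.
by move=> h; exists r, c; rewrite !mem_iota; split=> //; lia.
Qed.

Lemma box_bounds x :
  (0 < row x <= size alpha) && (0 < col x <= nth 0 alpha (row x).-1).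
Proof. by rewrite -in_comp_diagram; apply: fsvalP. Qed.

Lemma comp_diagram_box c r : 0 < r <= size alpha -> 0 < c <= nth 0 alpha r.-1 ->
  exists x, col x = c /\ row x = r.
Proof.
move=> hr hc; have cr : (c, r) \in comp_diagram alpha.
  by rewrite in_comp_diagram hr.
by exists [` cr]%fset.
Qed.

Lemma left_box y : 1 < col y -> exists w, (col w).+1 = col y /\ row w = row y.
Proof.
move=> c1; have := box_bounds y => h.
have [||w [cw rw]] := @comp_diagram_box (col y).-1 (row y); [lia..|].
by exists w; rewrite cw rw; split=> //; lia.
Qed.

Lemma sumn_take_leq r r' : r <= r' -> sumn (take r alpha) <= sumn (take r' alpha).
Proof.
by move=> le; rewrite -(take_takel alpha le) -{2}(cat_take_drop r (take r' alpha))
  sumn_cat leq_addr.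
Qed.

Lemma flatten_index_lt r c r' c' : r < r' -> c < nth 0 alpha r ->
  flatten_index alpha r c < flatten_index alpha r' c'.
Proof.
move=> lt_r lt_c; rewrite /flatten_index /=.
have lt_rs : r < size alpha.
  by rewrite ltnNge; apply: contraTN lt_c => le; rewrite nth_default.
have := sumn_take_leq lt_r; rewrite (take_nth 0) // -cats1 sumn_cat /=; lia.
Qed.

(** * Filling a composition diagram row by row *)

Section RowFilling.

Context (n : nat) (off : comp_diagram alpha -> nat).
Hypothesis sum_alpha : sumn alpha = n.
Hypothesis off_bound : forall x, off x < nth 0 alpha (row x).-1.
Hypothesis off_inj : forall x y, row x = row y -> off x = off y -> col x = col y.
Hypothesis off_onto : forall r c, 0 < r <= size alpha -> c < nth 0 alpha r.-1 ->
  exists x, row x = r /\ off x = c.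

(** The order inside a row is left to [off], so that one construction serves decreasing and
    increasing rows. Rows and labels start at 1, [flatten_index] at 0. *)
Definition row_filling : filling (comp_diagram alpha) n :=
  [ffun x => inord (flatten_index alpha (row x).-1 (off x)).+1].

Lemma row_fillingE x :
  row_filling x = (flatten_index alpha (row x).-1 (off x)).+1 :> nat.
Proof.
rewrite ffunE inordK // ltnS -sum_alpha.
(* A fictitious row after the last one would start at index [sumn alpha], which bounds all
   indices. *)
have := @flatten_index_lt _ _ (size alpha) 0 _ (off_bound x).
by rewrite /flatten_index /= take_size addn0; apply; have := box_bounds x; lia.
Qed.

Lemma row_filling_lt x y : row x < row y -> row_filling x < row_filling y.
Proof.
move=> lt_r; rewrite !row_fillingE ltnS; apply: flatten_index_lt => //.
by have := box_bounds x; lia.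
Qed.

Lemma row_filling_ltE x y :
  row x = row y -> (row_filling x < row_filling y) = (off x < off y).
Proof. by move=> e; rewrite !row_fillingE e /flatten_index /= ltnS ltn_add2l. Qed.

Lemma row_filling_standard : standard row_filling.
Proof.
apply/andP; split.
  apply/injectiveP => x y /(congr1 val) /= e.
  have er : row x = row y.
    case: (ltngtP (row x) (row y)) => // /row_filling_lt; rewrite e; lia.
  apply: box_eq => //; apply: off_inj => //.
  have := row_filling_ltE er; have := row_filling_ltE (esym er); rewrite e; lia.
apply/forallP => k; apply/eqP; apply/codomP/idP => [[x ->]|k0].
  by rewrite row_fillingE.
(* The box with label [k] is found by splitting [k.-1] into a row index and an offset. *)
have lt_k : k.-1 < sumn alpha by have := ltn_ord k; lia.
have [||x [rx ox]] := @off_onto (reshape_index alpha k.-1).+1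
    (reshape_offset alpha k.-1).
- by have := reshape_indexP lt_k.
- exact: reshape_offsetP.
exists x; apply: val_inj; rewrite /= row_fillingE rx ox /=.
by have := reshape_indexK alpha k.-1; rewrite /flatten_index /=; lia.
Qed.

End RowFilling.

(** * Defining conditions and nonemptiness of the two families *)

Context (n : nat).
Implicit Types T : filling (comp_diagram alpha) n.

Lemma SRCTP T : reflect
  [/\ standard T,
      forall x y, row x = row y -> col x < col y -> T y < T x,
      forall x y, col x = 1 -> col y = 1 -> row x < row y -> T x < T y
    & forall x y, col y = (col x).+1 -> row x < row y -> T y < T x ->
      exists z, [/\ col z = (col x).+1, row z = row x & T y < T z]]
  (T \in SRCT alpha n).
Proof.
rewrite inE; apply: (iffP and4P) => -[Tst Trow Tcol Ttri]; split=> //.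
- move=> x y /eqP rxy cxy; have /forallP/(_ y)/implyP := forallP Trow x.
  by apply; rewrite rxy.
- move=> x y /eqP cx /eqP cy rxy; have /forallP/(_ y)/implyP := forallP Tcol x.
  by apply; rewrite cx cy.
- move=> x y /eqP cxy rxy Tyx; have /forallP/(_ y)/implyP := forallP Ttri x.
  rewrite cxy rxy Tyx => /(_ isT)/existsP[z /and3P[/eqP cz /eqP rz Tyz]].
  by exists z.
- apply/forallP => x; apply/forallP => y; apply/implyP => /andP[/eqP rxy cxy].
  exact: Trow.
- apply/forallP => x; apply/forallP => y.
  by apply/implyP => /and3P[/eqP cx /eqP cy]; apply: Tcol.
apply/forallP => x; apply/forallP => y; apply/implyP => /and3P[/eqP cxy rxy Tyx].
have [z [cz rz Tyz]] := Ttri x y cxy rxy Tyx.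
by apply/existsP; exists z; rewrite cz rz !eqxx.
Qed.

Lemma SYRTP T : reflect
  [/\ standard T,
      forall x y, row x = row y -> col x < col y -> T x < T y,
      forall x y, col x = 1 -> col y = 1 -> row x < row y -> T x < T y
    & forall x y, col y = (col x).+1 -> row y < row x -> T x < T y ->
      exists z, [/\ col z = (col x).+1, row z = row x & T z < T y]]
  (T \in SYRT alpha n).
Proof.
rewrite inE; apply: (iffP and4P) => -[Tst Trow Tcol Ttri]; split=> //.
- move=> x y /eqP rxy cxy; have /forallP/(_ y)/implyP := forallP Trow x.
  by apply; rewrite rxy.
- move=> x y /eqP cx /eqP cy rxy; have /forallP/(_ y)/implyP := forallP Tcol x.
  by apply; rewrite cx cy.
- move=> x y /eqP cxy rxy Txy; have /forallP/(_ y)/implyP := forallP Ttri x.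
  rewrite cxy rxy Txy => /(_ isT)/existsP[z /and3P[/eqP cz /eqP rz Tzy]].
  by exists z.
- apply/forallP => x; apply/forallP => y; apply/implyP => /andP[/eqP rxy cxy].
  exact: Trow.
- apply/forallP => x; apply/forallP => y.
  by apply/implyP => /and3P[/eqP cx /eqP cy]; apply: Tcol.
apply/forallP => x; apply/forallP => y; apply/implyP => /and3P[/eqP cxy rxy Txy].
have [z [cz rz Tzy]] := Ttri x y cxy rxy Txy.
by apply/existsP; exists z; rewrite cz rz !eqxx.
Qed.

Lemma SRCT_neq0 : sumn alpha = n -> SRCT alpha n != set0.
Proof.
(* Offsets count from the right end, which makes rows decrease. *)
move=> sum_alpha; pose off x := nth 0 alpha (row x).-1 - col x.
have off_bound x : off x < nth 0 alpha (row x).-1.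
  by rewrite /off; have := box_bounds x; lia.
have off_inj x y : row x = row y -> off x = off y -> col x = col y.
  rewrite /off => e; have := box_bounds x; have := box_bounds y; rewrite e; lia.
have off_onto r c : 0 < r <= size alpha -> c < nth 0 alpha r.-1 ->
    exists x, row x = r /\ off x = c.
  move=> hr hc; have [||x [cx rx]] := @comp_diagram_box (nth 0 alpha r.-1 - c) r.
  - by [].
  - by lia.
  by exists x; split=> //; rewrite /off rx cx; lia.
apply/set0Pn; exists (row_filling n off); apply/SRCTP; split.
- exact: row_filling_standard.
- move=> x y e cxy; rewrite row_filling_ltE // /off e.
  by have := box_bounds y; lia.
- by move=> x y _ _; apply: row_filling_lt.
(* Higher rows carry larger labels, so the triple rule holds vacuously. *)
by move=> x y _ /(row_filling_lt sum_alpha off_bound); lia.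
Qed.

Lemma SYRT_neq0 : sumn alpha = n -> SYRT alpha n != set0.
Proof.
move=> sum_alpha; pose off x := (col x).-1.
have off_bound x : off x < nth 0 alpha (row x).-1.
  by rewrite /off; have := box_bounds x; lia.
have off_inj x y : row x = row y -> off x = off y -> col x = col y.
  by rewrite /off => e; have := box_bounds x; have := box_bounds y; lia.
have off_onto r c : 0 < r <= size alpha -> c < nth 0 alpha r.-1 ->
    exists x, row x = r /\ off x = c.
  move=> hr hc; have [||x [cx rx]] := @comp_diagram_box c.+1 r; [by []..|].
  by exists x; split=> //; rewrite /off cx.
apply/set0Pn; exists (row_filling n off); apply/SYRTP; split.
- exact: row_filling_standard.
- move=> x y e cxy; rewrite row_filling_ltE // /off.
  by have := box_bounds x; lia.
- by move=> x y _ _; apply: row_filling_lt.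
by move=> x y _ /(row_filling_lt sum_alpha off_bound); lia.
Qed.

(** * Descents and attacking pairs in the two families *)

Lemma SRCT_read_lt T i x y : T \in SRCT alpha n ->
  T x = i :> nat -> T y = i.+1 :> nat ->
  read_lt (srct_order (comp_diagram alpha)) y x = ~~ (col y < col x).
Proof.
case/SRCTP=> Tst Trow Tcol Ttri Tx Ty.
have nyx : y != x by apply: contra_eq_neq Ty => ->; rewrite Tx; lia.
have rowD : col x = col y -> row x != row y.
  by move=> e; apply: contraNneq nyx => er; apply/eqP/box_eq.
rewrite /read_lt nyx andbT /= /srct_le -leqNgt.
case: (ltngtP (col x) (col y)) => //= e.
have := rowD e; case: (eqVneq (col y) 1) => c1 nr.
  case: (leqP (row x) (row y)) => // lt_r.
  by have := Tcol _ _ c1 (etrans e c1) lt_r; lia.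
case: (leqP (row y) (row x)) => // lt_r.
(* If [x] were below [y], its left neighbour [w] would exceed [i] and differ from [i.+1], hence
   exceed [T y]. The triple rule for [w] and [y] would then force [T y < T x]. *)
have [|w [cw rw]] := @left_box x; first by have := box_bounds y; lia.
have Twx : T x < T w by apply: Trow => //; lia.
have nTwy : T w != T y :> nat.
  by apply/eqP => /(standard_inj Tst) Ewy; move: cw; rewrite Ewy; lia.
have [|||z [cz rz Tyz]] := Ttri w y; [lia | lia | lia |].
have Ezx : z = x by apply: box_eq; lia.
by move: Tyz; rewrite Ezx; lia.
Qed.

Lemma SYRT_read_lt T i x y : T \in SYRT alpha n ->
  T x = i :> nat -> T y = i.+1 :> nat ->
  read_lt (syrt_order (comp_diagram alpha)) y x = ~~ (col y <= col x).
Proof.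
case/SYRTP=> Tst Trow Tcol Ttri Tx Ty.
have nyx : y != x by apply: contra_eq_neq Ty => ->; rewrite Tx; lia.
have rowD : col x = col y -> row x != row y.
  by move=> e; apply: contraNneq nyx => er; apply/eqP/box_eq.
rewrite /read_lt nyx andbT /= /syrt_le -ltnNge.
case: (ltngtP (col x) (col y)) => //= e.
have := rowD e; case: (eqVneq (col y) 1) => c1 nr.
  case: (leqP (row y) (row x)) => // le_r.
  have lt_r : row y < row x by lia.
  by have := Tcol _ _ c1 (etrans e c1) lt_r; lia.
case: (leqP (row x) (row y)) => // le_r.
(* Dually, if [y] were above [x], its left neighbour [w] would carry a label below [i], and the
   triple rule for [w] and [x] would force [T y < T x]. *)
have [|w [cw rw]] := @left_box y; first by have := box_bounds y; lia.
have Twy : T w < T y by apply: Trow => //; lia.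
have nTwx : T w != T x :> nat.
  by apply/eqP => /(standard_inj Tst) Ewx; move: cw; rewrite Ewx; lia.
have [|||z [cz rz Tzx]] := Ttri w x; [lia | lia | lia |].
have Ezy : z = y by apply: box_eq; lia.
by move: Tzx; rewrite Ezy; lia.
Qed.

Lemma SRCT_swap_entries T i x y : T \in SRCT alpha n -> 0 < i < n ->
  T x = i :> nat -> T y = i.+1 :> nat -> ~~ (col y < col x) ->
  (swap_entries i T \in SRCT alpha n) =
  ~~ ((col x <= col y) && ((col x == col y) ||
     (row x < row y) && (col y == (col x).+1))).
Proof.
move=> TS i_n Tx Ty; rewrite -leqNgt => cxy; rewrite cxy /=.
have /andP[_ lt_in] := i_n; have [Tst Trow Tcol Ttri] := SRCTP _ TS.
have atx u : T u = i :> nat -> u = x.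
  by rewrite -Tx; apply: standard_inj.
have aty u : T u = i.+1 :> nat -> u = y.
  by rewrite -Ty; apply: standard_inj.
have sTx := swap_entries_lo lt_in Tx; have sTy := swap_entries_hi lt_in Ty.
apply/idP/norP => [sTS | [nc nadj]].
  split; apply/negP.
    (* Within a column the larger of two consecutive labels is read first, which cannot hold both
       before and after the exchange. *)
    move=> /eqP e; have := SRCT_read_lt sTS sTy sTx; have := SRCT_read_lt TS Tx Ty.
    by rewrite e ltnn /= => /read_lt_asym ->.
  case/andP=> lt_r /eqP cS; case/SRCTP: sTS => sTst sTrow _ sTtri.
  (* The box [z] right of [x] would need a label strictly between [i] and [i.+1]. *)
  have [|z [cz rz]] := sTtri x y cS lt_r; first by rewrite sTx sTy.
  by have := sTrow x z (esym rz); rewrite cz sTx sTy => /(_ (leqnn _)); lia.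
apply/SRCTP; split; first exact: standard_swap_entries.
- move=> u v ruv cuv; have Tvu := Trow _ _ ruv cuv.
  by have [[/atx Ev /aty Eu]|//] := swap_entries_lt lt_in Tvu; subst u v; lia.
- move=> u v cu cv ruv; have Tuv := Tcol _ _ cu cv ruv.
  by have [[/atx Eu /aty Ev]|//] := swap_entries_lt lt_in Tuv; subst u v; lia.
(* The only new instance of the triple rule compares [x] with [y], which is the excluded adjacent
   position. In old instances the witness survives, as [x] and [y] lie in different columns. *)
move=> u v cuv ruv /(swap_entries_gt lt_in)[[/aty Ev /atx Eu]|Tvu].
  by subst u v; rewrite cuv ruv eqxx in nadj.
have [z [cz rz Tvz]] := Ttri _ _ cuv ruv Tvu; exists z; split=> //.
have [[/atx Ev /aty Ez]|//] := swap_entries_lt lt_in Tvz.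
by subst v z; lia.
Qed.

Lemma SYRT_swap_entries T i x y : T \in SYRT alpha n -> 0 < i < n ->
  T x = i :> nat -> T y = i.+1 :> nat -> ~~ (col y <= col x) ->
  (swap_entries i T \in SYRT alpha n) =
  ~~ ((row x == row y) && (col y == (col x).+1)).
Proof.
move=> TS i_n Tx Ty; rewrite -ltnNge => cxy.
have /andP[_ lt_in] := i_n; have [Tst Trow Tcol Ttri] := SYRTP _ TS.
have atx u : T u = i :> nat -> u = x.
  by rewrite -Tx; apply: standard_inj.
have aty u : T u = i.+1 :> nat -> u = y.
  by rewrite -Ty; apply: standard_inj.
have sTx := swap_entries_lo lt_in Tx; have sTy := swap_entries_hi lt_in Ty.
apply/idP/idP => [/SYRTP[_ sTrow _ _] | nadj].
  by apply/negP => /andP[/eqP rxy _]; have := sTrow _ _ rxy cxy; lia.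
apply/SYRTP; split; first exact: standard_swap_entries.
- move=> u v ruv cuv; have Tuv := Trow _ _ ruv cuv.
  have [[/atx Eu /aty Ev]|//] := swap_entries_lt lt_in Tuv; subst u v.
  (* In a common row, nonadjacent [x] and [y] have a box between them, whose label would lie
     strictly between [i] and [i.+1]. *)
  have [|w [cw rw]] := @left_box y; first by have := box_bounds x; lia.
  rewrite ruv eqxx /= in nadj.
  have Txw : T x < T w by apply: Trow; lia.
  by have : T w < T y by [apply: Trow; lia]; lia.
- move=> u v cu cv ruv; have Tuv := Tcol _ _ cu cv ruv.
  by have [[/atx Eu /aty Ev]|//] := swap_entries_lt lt_in Tuv; subst u v; lia.
move=> u v cuv ruv /(swap_entries_gt lt_in)[[/aty Eu /atx Ev]|Tuv].
  by subst u v; lia.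
have [z [cz rz Tzv]] := Ttri _ _ cuv ruv Tuv; exists z; split=> //.
have [[/atx Ez /aty Ev]|//] := swap_entries_lt lt_in Tzv.
by subst v z; lia.
Qed.

End CompositionDiagram.

Theorem theorem7p7 (R : realType) (n : nat) (alpha : seq nat)
    (halpha : is_composition n alpha) :
  is_diagram_module (srct_order (comp_diagram alpha)) (SRCT alpha n)
    (@srct_op (complex R) alpha n)
  /\
  is_diagram_module (syrt_order (comp_diagram alpha)) (SYRT alpha n)
    (@syrt_op (complex R) alpha n).
Proof.
have /andP[_ /eqP sum_alpha] := halpha.
(* Unification reads [asc] and [att] off the known actions. *)
split; apply: local_diagram_module.
- exact: SRCT_neq0.
- by move=> T /SRCTP[].
- exact: SRCT_read_lt.
- exact: SRCT_swap_entries.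
- exact: SYRT_neq0.
- by move=> T /SYRTP[].
- exact: SYRT_read_lt.
exact: SYRT_swap_entries.
Qed.
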